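(* Let $\rho_r\in(0,1)$, $\rho_w\in(0,1/2)$, $\epsilon>0$ with $\rho_r<1-h(\rho_w)-2\epsilon$. Let $C\subseteq\{0,1\}^n$ consist of $2^{Rn}$ independent uniformly random vectors, $R=1-h(\rho_w)-\epsilon$, and let $\Pi=\{A_i\}$ be a partition of $C$ into $2^{Rn-\ell}$ subsets of size $2^{\ell}$, where $\ell=\rho_r n-O(1)$ (for a suitable constant). Then with high probability over the choices of $C$ and $\Pi$, the stochastic code $C_\Pi$ that maps the $i$-th message $m_i\in\{0,1\}^{Rn-\ell}$ to a uniformly random element of $A_i$ has rate at least $1-h(\rho_w)-\rho_r-\epsilon$ and achieves reliability and weak secrecy over the $(\rho_r,\rho_w)$ adversarial wiretap channel.
   Context: $h$ is the binary entropy function. The $(\rho_r,\rho_w)$ adversarial wiretap channel: the transmitted codeword $x\in\{0,1\}^n$ encodes message $\mathbf S$; the adversary picks $\mathscr S\subseteq[n]$ of size $\rho_r n$, sees $\mathbf V(\mathscr S)\in\{0,1,?\}^n$ ($x_i$ on $\mathscr S$, $?$ elsewhere), and adds an error of Hamming weight at most $\rho_w n$ whose distribution depends only on the code and the view; the receiver uses nearest-neighbor decoding. Reliability: $\Pr[\hat{\mathbf S}\ne\mathbf S]\to0$ as $n\to\infty$ for uniform messages, against every adversary. Weak secrecy: with $\mathbf S$ uniform, $\frac1n\min_{|\mathscr S|=\rho_r n}H(\mathbf S\mid\mathbf V(\mathscr S))$ tends to the rate of the code as $n\to\infty$. *)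

(* Defs.v *)
From HB Require Import structures.
From mathcomp Require Import all_boot perm.
From Stdlib Require Import Reals ClassicalEpsilon.

Set Implicit Arguments.
Unset Strict Implicit.
Unset Printing Implicit Defensive.

Definition log2 (x : R) : R := (ln x / ln 2)%R.
Definition hbin (p : R) : R := (- p * log2 p - (1 - p) * log2 (1 - p))%R.
(** floor of a real, as a natural number (0 for negative reals) *)
Definition floorR (x : R) : nat := Z.to_nat (Int_part x).
Definition pb (P : Prop) : bool := if excluded_middle_informative P then true else false.
Definition sumR (T : finType) (F : T -> R) : R := \big[Rplus/0%R]_(t : T) F t.

(** Binary words of length n, adversary views in {0,1,?}^n (None = ?) *)
Definition word (n : nat) := {ffun 'I_n -> bool}.
Definition view (n : nat) := {ffun 'I_n -> option bool}.
Definition hdist n (x y : word n) : nat := #|[set i | x i != y i]|.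
Definition weight n (e : word n) : nat := #|[set i | e i]|.
Definition addw n (x e : word n) : word n := [ffun i => xorb (x i) (e i)].
Definition vmask n (S : {set 'I_n}) (x : word n) : view n :=
  [ffun i => if i \in S then Some (x i) else None].

(** A stochastic code with M messages and L codewords per message:
    message m is encoded as c m j with j uniform in 'I_L. *)
Definition scode (n M L : nat) := 'I_M -> 'I_L -> word n.

Definition nn_dec n M L (c : scode n M L) (y : word n) : option 'I_M :=
  omap (fun p : 'I_M * 'I_L => p.1)
    [pick p : 'I_M * 'I_L |
       [forall q : 'I_M * 'I_L, (hdist (c p.1 p.2) y <= hdist (c q.1 q.2) y)%N]].

Definition valid_adv n (tw : nat) (A : view n -> word n -> R) : Prop :=
  forall v : view n,
    (forall e, (0 <= A v e)%R) /\ sumR (A v) = 1%R /\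
    (forall e, A v e <> 0%R -> (weight e <= tw)%N).

Definition err_prob n M L (c : scode n M L) (S : {set 'I_n})
    (A : view n -> word n -> R) : R :=
  sumR (fun m : 'I_M => sumR (fun j : 'I_L => sumR (fun e : word n =>
    (/ INR M * / INR L * A (vmask S (c m j)) e *
     (if nn_dec c (addw (c m j) e) == Some m then 0 else 1))%R))).

Definition reliable n M L (c : scode n M L) (tr tw : nat) (delta : R) : Prop :=
  forall (S : {set 'I_n}), #|S| = tr ->
  forall A : view n -> word n -> R, valid_adv tw A ->
    (err_prob c S A <= delta)%R.

Definition pjoint n M L (c : scode n M L) (S : {set 'I_n}) (m : 'I_M) (v : view n) : R :=
  (/ INR M * / INR L * INR #|[set j : 'I_L | vmask S (c m j) == v]|)%R.
Definition pview n M L (c : scode n M L) (S : {set 'I_n}) (v : view n) : R :=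
  sumR (fun m : 'I_M => pjoint c S m v).
Definition condH n M L (c : scode n M L) (S : {set 'I_n}) : R :=
  sumR (fun m : 'I_M => sumR (fun v : view n =>
    let p := pjoint c S m v in
    if Req_EM_T p 0 then 0%R else (p * log2 (pview c S v / p))%R)).

Definition rate (n M : nat) : R := (log2 (INR M) / INR n)%R.

(** Weak secrecy up to delta: every read set S of size tr leaves
    (1/n) H(S | V(S)) within delta of the rate (equivalently, the minimum
    over S is within delta of the rate). *)
Definition secret n M L (c : scode n M L) (tr : nat) (delta : R) : Prop :=
  forall (S : {set 'I_n}), #|S| = tr ->
    (Rabs (condH c S / INR n - rate n M) <= delta)%R.

(** The stochastic code C_Pi built from a codebook cb of M*L codewords
    (indexed by 'I_M * 'I_L) and a permutation sigma: the partition
    Pi = {A_m}, A_m = {cb (sigma (m,j)) | j}, message m -> uniform in A_m. *)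
Definition CPi n M L (cb : {ffun 'I_M * 'I_L -> word n}) (sigma : {perm 'I_M * 'I_L})
  : scode n M L := fun m j => cb (sigma (m, j)).

Definition uprob (T : finType) (E : pred T) : R :=
  (INR #|[set t | E t]| / INR #|T|)%R.

Definition kbits (rw eps : R) (n : nat) : nat := floorR ((1 - hbin rw - eps) * INR n).
Definition lbits (rr : R) (c n : nat) : nat := (floorR (rr * INR n) - c)%N.

Definition good_prob (rr rw eps : R) (c n : nat) (delta : R) : R :=
  let k := kbits rw eps n in
  let l := lbits rr c n in
  let M := (2 ^ (k - l))%N in
  let L := (2 ^ l)%N in
  let tr := floorR (rr * INR n) in
  let tw := floorR (rw * INR n) in
  uprob (fun cs : {ffun 'I_M * 'I_L -> word n} * {perm 'I_M * 'I_L} =>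
    pb ((1 - hbin rw - rr - eps <= rate n M)%R /\
        reliable (CPi cs.1 cs.2) tr tw delta /\
        secret (CPi cs.1 cs.2) tr delta)).

(* Main.v *)
Require Import Defs.
From HB Require Import structures.
From mathcomp Require Import all_boot perm zify.
From Stdlib Require Import ZArith Reals Lra ClassicalEpsilon FunctionalExtensionality.
(* Imported again after the reals so that [^] and [%N] denote ssrnat notations. *)
From mathcomp Require Import ssrnat.

Set Implicit Arguments.
Unset Strict Implicit.
Unset Printing Implicit Defensive.

(** Everything reduces to counting codebooks. An event on a random codebook that
    involves few coordinates is independent of events on disjoint coordinates, so
    the expected number of ordered [t]-tuples of disjoint occurrences of such
    events is at most the [t]-th power of the expected number of occurrences;
    Markov's inequality for a large constant [t] then gives tails that survive
    union bounds over read sets, views and error vectors.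

    Reliability: a codeword is confusable if another codeword falls in the Hamming
    ball around its corrupted version. Every ball contains boundedly many
    codewords, so many confusable codewords with a given view yield many disjoint
    confused pairs, whose expected number is smaller by [2^(- eps n)] than the
    number of codewords with that view.

    Secrecy: a message has [2^l = 2^(tr - 4)] codewords, so at most [n] of them
    share a given view; as there are only [2^tr] views, Gibbs' inequality shows
    that the view reveals at most [4 + log2 n] bits. *)

Lemma card_bigcup_le (I T : finType) (P : pred I) (F : I -> {set T}) :
  #|\bigcup_(i | P i) F i| <= \sum_(i | P i) #|F i|.
Proof.
elim/big_rec2: _ => [|i m A _ IH]; first by rewrite cards0.
by rewrite cardsU; apply: leq_trans (leq_subr _ _) _; rewrite leq_add2l.
Qed.

(** * Independence of events on disjoint coordinates *)

Section Independence.
Variables (D W : finType).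
Implicit Types (f g : {ffun D -> W}) (A B : {set D}) (P Q : pred {ffun D -> W}).

Definition local A P := forall f g, {in A, f =1 g} -> P f = P g.

Definition mix A f g : {ffun D -> W} := [ffun d => if d \in A then f d else g d].

(* Exchanging the [A]-coordinates of two independent codebooks decouples [P] from [Q]. *)
Lemma card_indep A B P Q : local A P -> local B Q -> [disjoint A & B] ->
  #|[set f | P f && Q f]| * #|{: {ffun D -> W}}| = #|[set f | P f]| * #|[set f | Q f]|.
Proof.
move=> locP locQ dAB.
pose swap (fg : {ffun D -> W} * {ffun D -> W}) := (mix A fg.1 fg.2, mix A fg.2 fg.1).
have swapK : involutive swap.
  by case=> f g; congr pair; apply/ffunP => d; rewrite !ffunE /= ?ffunE; case: (d \in A).
rewrite -cardsT -!cardsX -(card_imset (setX [set f | P f] _) (inv_inj swapK)).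
apply: eq_card => -[f g]; rewrite -[in RHS](swapK (f, g)) mem_imset ?inE; last exact: inv_inj.
rewrite andbT; congr (_ && _).
  by apply: locP => d dA; rewrite ffunE dA.
apply: locQ => d dB; rewrite /= ffunE ifF //.
by apply/negP => dA; rewrite (disjointFr dAB dA) in dB.
Qed.

Definition upd f d w : {ffun D -> W} := [ffun e => if e == d then w else f e].

(** Swapping [f d] with a fresh letter [w] is an involution on pairs [(f, w)]. As [E] ignores the
    coordinate [d] of its codebook argument, the swap carries [E f (f d)] to [E f w]. *)
Lemma card_resample d (E : {ffun D -> W} -> pred W) :
  (forall f v w, E (upd f d v) w = E f w) ->
  #|[set f : {ffun D -> W} | E f (f d)]| * #|W| = \sum_f #|[set w | E f w]|.
Proof.
move=> indE.
pose swap (fw : {ffun D -> W} * W) := (upd fw.1 d fw.2, fw.1 d).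
have swapK : involutive swap.
  case=> f w; rewrite /swap /= ffunE eqxx; congr pair; apply/ffunP => e.
  by rewrite !ffunE; case: eqP => [->|].
rewrite -[#|W|]cardsT -cardsX -(card_imset _ (inv_inj swapK)).
transitivity #|[set fw : {ffun D -> W} * W | E fw.1 fw.2]|.
  apply: eq_card => -[f w]; rewrite -[in LHS](swapK (f, w)) mem_imset; last exact: inv_inj.
  by rewrite !inE /= ffunE eqxx indE andbT.
rewrite -sum1_card (eq_bigl (fun p : {ffun D -> W} * W => xpredT p.1 && E p.1 p.2)); last first.
  by move=> p; rewrite inE.
rewrite -(pair_big_dep xpredT (fun f w => E f w) (fun _ _ => 1)) /=.
by apply: eq_bigr => f _; rewrite sum1dep_card.
Qed.

Lemma card_marginal d (X : {set W}) :
  #|[set f : {ffun D -> W} | f d \in X]| * #|W| = #|X| * #|{: {ffun D -> W}}|.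
Proof.
rewrite (card_resample (E := fun _ w => w \in X)) // sum_nat_const mulnC; congr (_ * _).
by apply: eq_card => w; rewrite inE.
Qed.

End Independence.

(** * Moment method for disjoint occurrences *)

Section Moments.
Variables (D W E : finType) (supp : E -> {set D}) (ev : E -> pred {ffun D -> W}).
Hypothesis ev_local : forall x, local (supp x) (ev x).
Implicit Types (f : {ffun D -> W}) (A : {set D}).

(* The number of ordered [t]-tuples of events occurring in [f] whose supports are
   disjoint from each other and from [A]. *)
Fixpoint chains f t A := if t is t'.+1 then
  \sum_(x | ev x f && [disjoint A & supp x]) chains f t' (A :|: supp x) else 1.

(** The first event of a chain is supported off [A], hence independent of [P], and costs a factor
    [u / v]. It is then absorbed into [P], and its support into [A]; this is why the induction runs
    over all [A] and [P]. *)
Lemma sum_chains u v t A (P : pred {ffun D -> W}) :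
  (forall x, #|[set f | ev x f]| * v <= u * #|{: {ffun D -> W}}|) -> local A P ->
  (\sum_(f | P f) chains f t A) * v ^ t <= (#|E| * u) ^ t * #|[set f | P f]|.
Proof.
move=> prob_ev; elim: t A P => [|t IHt] A P locP /=.
  by rewrite sum1dep_card !expn0 muln1 mul1n.
under eq_bigr do rewrite big_mkcondl.
rewrite exchange_big /= big_distrl /=.
(* Independence is stated after multiplication by the number of codebooks, which must be positive to
   be cancelled. *)
case: (posnP #|{: {ffun D -> W}}|) => [F0|Fpos].
  rewrite big1 // => x _; rewrite big1 // => f _.
  by have := F0; rewrite (cardD1 f).
rewrite -(leq_pmul2r Fpos) big_distrl /=.
have -> : (#|E| * u) ^ t.+1 * #|[set f | P f]| * #|{: {ffun D -> W}}| =
  \sum_(x : E) (#|E| * u) ^ t * (u * #|[set f | P f]| * #|{: {ffun D -> W}}|).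
  by rewrite sum_nat_const expnSr -!mulnA [LHS]mulnCA.
rewrite big_mkcond /=; apply: leq_sum => x _; case: ifP => // dAx.
rewrite -big_mkcondr /= expnSr.
have locPx : local (A :|: supp x) (fun f => P f && ev x f).
  move=> f g fg; congr (_ && _); [apply: locP|apply: ev_local] => d dIn; apply: fg;
  by rewrite inE dIn ?orbT.
have := IHt _ _ locPx.
have := card_indep locP (@ev_local x) dAx; have := prob_ev x.
move=> le_ev indep le_IH.
rewrite mulnA; apply: leq_trans (leq_mul (leq_mul le_IH (leqnn _)) (leqnn _)) _.
rewrite -!mulnA leq_mul2l; apply/orP; right.
rewrite mulnCA indep [leqRHS]mulnCA mulnCA leq_mul2l; apply/orP; right.
by rewrite mulnC.
Qed.

(** Greedy choice: each coordinate lies in at most [K] occurring events and each step adds at most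
    [s] coordinates to [A], so [b] choices remain at each of the [t] steps. *)
Lemma chains_ge f K s b t A :
  (forall x, #|supp x| <= s) -> (forall d, #|[set x | ev x f & d \in supp x]| <= K) ->
  b + K * (#|A| + s * t) <= #|[set x | ev x f]| -> b ^ t <= chains f t A.
Proof.
move=> leS leK; elim: t A => [|t IHt] A lb //=.
set Z := [set x | ev x f] in lb.
pose N := [set x in Z | ~~ [disjoint A & supp x]].
have leN : #|N| <= K * #|A|.
  have /subset_leq_card/leq_trans -> // :
      N \subset \bigcup_(d in A) [set x | ev x f & d \in supp x].
    apply/subsetP => x; rewrite !inE => /andP[evx /pred0Pn[d /andP[dA dx]]].
    by apply/bigcupP; exists d => //; rewrite inE evx.
  apply: leq_trans (card_bigcup_le _ _) _ => /=.
  by rewrite mulnC -sum_nat_const leq_sum.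
have le_b : b <= #|Z :\: N|.
  rewrite cardsD; have := subset_leq_card (subsetIr Z N); nia.
rewrite expnS; apply: (@leq_trans (\sum_(x in Z :\: N) b ^ t)).
  by rewrite sum_nat_const leq_mul2r le_b orbT.
rewrite (eq_bigl (fun x => ev x f && [disjoint A & supp x])); last first.
  by move=> x; rewrite !inE; case: (ev x f) => //=; rewrite negbK andbT.
apply: leq_sum => x _; apply: IHt.
have := leS x; have := cardsU A (supp x); rewrite -/Z; nia.
Qed.

(** Markov's inequality for the number of chains, starting from the empty set and the full space. *)
Lemma card_many_events K s b u v t : 
  (forall x, #|supp x| <= s) ->
  (forall x, #|[set f | ev x f]| * v <= u * #|{: {ffun D -> W}}|) ->
  #|[set f | [forall d, #|[set x | ev x f & d \in supp x]| <= K] &&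
             (b + K * (s * t) <= #|[set x | ev x f]|)]| * (b * v) ^ t
    <= (#|E| * u) ^ t * #|{: {ffun D -> W}}|.
Proof.
move=> leS prob_ev.
have := @sum_chains u v t set0 xpredT prob_ev (fun f g _ => erefl).
rewrite (_ : [set f | xpredT f] = setT) ?cardsT; last by apply/setP => f; rewrite !inE.
apply: leq_trans; rewrite expnMn mulnA leq_mul2r; apply/orP; right.
rewrite -sum_nat_const big_mkcond /=; apply: leq_sum => f _.
case: ifP => //; rewrite inE => /andP[/forallP leK lb].
by apply: chains_ge leS leK _; rewrite cards0 add0n.
Qed.

End Moments.

(** * Tail bounds for numbers of occurrences *)

Section Tails.
Variables (D W : finType).

(** By injectivity the supports [[set g x]] are pairwise disjoint, so the moment bound applies with
    [K = s = b = 1]. *)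
Lemma card_many_hits (E : finType) (g : E -> D) (X : {set W}) t : injective g ->
  #|[set f : {ffun D -> W} | t < #|[set x | f (g x) \in X]|]| * #|W| ^ t
    <= (#|E| * #|X|) ^ t * #|{: {ffun D -> W}}|.
Proof.
move=> g_inj.
pose supp x := [set g x]; pose ev x (f : {ffun D -> W}) := f (g x) \in X.
have evL x : local (supp x) (ev x) by move=> f h fh; rewrite /ev fh ?inE.
have := @card_many_events D W E supp ev evL 1 1 1 #|X| #|W| t.
rewrite !mul1n; set B := [set f | _ & _] => bound.
apply: leq_trans (bound _ _).
- rewrite leq_mul2r; apply/orP; right; apply/subset_leq_card/subsetP => f.
  rewrite !inE add1n => ->; rewrite andbT; apply/forallP => d.
  apply/card_le1_eqP => x y; rewrite !inE => /andP[_ /eqP ->] /andP[_ /eqP].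
  by move/g_inj.
- by move=> x; rewrite cards1.
- by move=> x; rewrite card_marginal.
Qed.

Definition near_pairs (X : {set W}) (Y : W -> {set W}) (f : {ffun D -> W}) : {set D * D} :=
  [set pq | (pq.1 != pq.2) && (f pq.1 \in X) && (f pq.2 \in Y (f pq.1))].

(** Resampling [f q] leaves [f p] fixed, so hitting [Y (f p)] costs a factor at most [v / #|W|]
    whatever [f p] is. *)
Lemma card_pair_event (X : {set W}) (Y : W -> {set W}) v p q :
  (forall w, #|Y w| <= v) ->
  #|[set f | (p, q) \in near_pairs X Y f]| * (#|W| * #|W|)
    <= #|X| * v * #|{: {ffun D -> W}}|.
Proof.
move=> leY; have [->|npq] := eqVneq p q.
  rewrite (_ : [set _ | _] = set0) ?cards0 //.
  by apply/setP => f; rewrite !inE eqxx.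
have -> : [set f | (p, q) \in near_pairs X Y f] =
    [set f : {ffun D -> W} | (f p \in X) && (f q \in Y (f p))].
  by apply/setP => f; rewrite !inE /= npq.
rewrite mulnA (card_resample (E := fun f w => (f p \in X) && (w \in Y (f p)))); last first.
  by move=> f v' w; rewrite ffunE (negbTE npq).
apply: (@leq_trans ((#|[set f : {ffun D -> W} | f p \in X]| * v) * #|W|)).
  rewrite leq_mul2r; apply/orP; right.
  rewrite -sum_nat_const [leqRHS]big_mkcond; apply: leq_sum => f _; rewrite inE.
  case: ifP => fp; last by rewrite eq_card0 // => w; rewrite inE.
  by apply: leq_trans (leY (f p)); apply/subset_leq_card/subsetP => w; rewrite inE.
by rewrite mulnAC card_marginal mulnAC.
Qed.

Lemma card_many_near_pairs (X : {set W}) (Y : W -> {set W}) v K b t :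
  (forall w, #|Y w| <= v) ->
  #|[set f | [forall d, #|[set pq in near_pairs X Y f | d \in [set pq.1; pq.2]]| <= K] &&
             (b + K * (2 * t) <= #|near_pairs X Y f|)]| * (b * (#|W| * #|W|)) ^ t
    <= (#|D| * #|D| * (#|X| * v)) ^ t * #|{: {ffun D -> W}}|.
Proof.
move=> leY.
pose supp (pq : D * D) := [set pq.1; pq.2].
pose ev pq (f : {ffun D -> W}) := pq \in near_pairs X Y f.
have evL x : local (supp x) (ev x).
  by move=> f h fh; rewrite /ev !inE !fh ?inE ?eqxx ?orbT.
rewrite -(card_prod D D).
have := @card_many_events D W _ supp ev evL K 2 b (#|X| * v) (#|W| * #|W|) t.
set B := [set f | _ & _] => bound.
apply: leq_trans (bound _ _).
- rewrite leq_mul2r; apply/orP; right; apply/subset_leq_card/subsetP => f.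
  rewrite [f \in [set _ | _]]inE [f \in B]inE => /andP[/forallP leK lb].
  apply/andP; split; last first.
    by rewrite (_ : [set x | ev x f] = near_pairs X Y f) //; apply/setP => x; rewrite inE.
  apply/forallP => d; apply: leq_trans (leK d); apply/subset_leq_card/subsetP => x.
  by rewrite !inE.
- by move=> x; rewrite cards2; case: (_ != _).
- by case=> p q; apply: card_pair_event.
Qed.
End Tails.

(** * Hamming balls and cells of words with a common view *)

Section Words.
Variable n : nat.
Implicit Types (x y e w : word n) (S : {set 'I_n}).

Lemma card_word : #|{: word n}| = 2 ^ n.
Proof. by rewrite card_ffun card_bool card_ord. Qed.

Lemma addwC x y : addw x y = addw y x.
Proof. by apply/ffunP => i; rewrite !ffunE; case: (x i); case: (y i). Qed.

Lemma addwA x y z : addw x (addw y z) = addw (addw x y) z.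
Proof. by apply/ffunP => i; rewrite !ffunE; case: (x i); case: (y i); case: (z i). Qed.

Lemma addwK e : involutive (fun x => addw x e).
Proof. by move=> x; apply/ffunP => i; rewrite !ffunE; case: (x i); case: (e i). Qed.

Lemma hdistE x y : hdist x y = weight (addw x y).
Proof.
by apply: eq_card => i; rewrite !inE ffunE; case: (x i); case: (y i).
Qed.

Definition ball y r : {set word n} := [set x | hdist x y <= r].
Definition vol r := #|[set e : word n | weight e <= r]|.

Lemma card_ball y r : #|ball y r| = vol r.
Proof.
rewrite -(card_imset _ (inv_inj (addwK y))); apply: eq_card => e.
rewrite -[in LHS](addwK y e) (mem_imset _ _ (inv_inj (addwK y))).
by rewrite !inE hdistE addwK.
Qed.

(** For a fixed error, confusion is symmetric; one bound on ball occupancy thus controls both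
    positions of an ordered pair. *)
Lemma ball_shift x y e r : (x \in ball (addw y e) r) = (y \in ball (addw x e) r).
Proof. by rewrite !inE !hdistE addwA (addwC x y) -addwA. Qed.

(** Cells are indexed by words rather than views, so that none is empty and all have the same
    size. *)
Definition cell S w : {set word n} := [set x | vmask S x == vmask S w].

Lemma cellP S w x : reflect {in S, x =1 w} (x \in cell S w).
Proof.
rewrite inE; apply: (iffP eqP) => [/ffunP eqv i iS|eqS].
  by have := eqv i; rewrite !ffunE iS => -[].
by apply/ffunP => i; rewrite !ffunE; case: ifP => // iS; rewrite eqS.
Qed.

Lemma card_cell S w : #|cell S w| * 2 ^ #|S| = 2 ^ n.
Proof.
have -> : #|cell S w| = #|finfun.family (fun i => [pred b | (i \in S) ==> (b == w i)])|.
  apply: eq_card => x; apply/cellP/familyP => eqS i; last first.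
    by move=> iS; have /implyP/(_ iS)/eqP := eqS i.
  by apply/implyP => iS; rewrite eqS.
(* Every position contributes a factor 2: through [2 ^ #|S|] inside [S], through the free bit of the
   cell outside. *)
rewrite card_family foldrE big_map big_enum /= -prod_nat_const.
rewrite [X in _ * X]big_mkcond /= -big_split /=.
rewrite (eq_bigr (fun=> 2)) ?prod_nat_const ?card_ord // => i _.
case: ifP => iS.
  by rewrite (eq_card (B := pred1 (w i))) ?card1.
by rewrite muln1 -card_bool; apply: eq_card => b.
Qed.
End Words.

(** All tail bounds are brought to this form: the exceptional fraction [N / F] is at most
    [2 ^ (b - a)], hence at most [2 ^ (- n)]. *)
Lemma leq_pow2_cancel N F a b n : N * 2 ^ a <= 2 ^ b * F -> b + n <= a -> N * 2 ^ n <= F.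
Proof.
move=> leNF le_ba; rewrite -(leq_pmul2l (expn_gt0 2 b)) mulnCA -expnD.
by apply: leq_trans leNF; rewrite leq_mul2l leq_exp2l // le_ba orbT.
Qed.

Lemma card_exists_le (T I : finType) (P : I -> pred T) c d :
  (forall i, #|[set x | P i x]| * c <= d) ->
  #|[set x | [exists i, P i x]]| * c <= #|I| * d.
Proof.
move=> leP; apply: (@leq_trans (\sum_i #|[set x | P i x]| * c)); last first.
  by rewrite -sum_nat_const leq_sum.
rewrite -big_distrl leq_mul2r; apply/orP; right.
apply: leq_trans (card_bigcup_le _ _); apply/subset_leq_card/subsetP => x.
by rewrite inE => /existsP[i Pix]; apply/bigcupP; exists i; rewrite ?inE.
Qed.

Lemma card_subsets n : #|{: {set 'I_n}}| = 2 ^ n.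
Proof. by rewrite -cardsT -powersetT card_powerset cardsT card_ord. Qed.

(** * Random codebooks *)

Section Codebooks.
Variables (n tw : nat) (D : finType).
Implicit Types (f : {ffun D -> word n}) (S : {set 'I_n}) (w e y : word n).

Definition crowded T f := [exists y, T < #|[set p | f p \in ball y tw]|].

(** Nearest-neighbor decoding can fail on an error of weight at most [tw] only if another codeword
    is within [tw] of the received word; these are the codewords with the view of [w] that [e] puts
    at risk. *)
Definition confused f S w e : {set D} :=
  [set p | (f p \in cell S w) && [exists q, (q != p) && (f q \in ball (addw (f p) e) tw)]].

Notation confusions S w e := (near_pairs (cell S w) (fun x => ball (addw x e) tw)).

Lemma card_confused_le f S w e : #|confused f S w e| <= #|confusions S w e f|.
Proof.
apply: leq_trans (leq_imset_card fst _); apply/subset_leq_card/subsetP => p.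
rewrite inE => /andP[fp /existsP[q /andP[qp fq]]].
by apply/imsetP; exists (p, q); rewrite // inE /= eq_sym qp fp.
Qed.

(** Whether [d] is the first or, by [ball_shift], the second entry of a pair, the other entry lies
    in the ball around [addw (f d) e], which holds at most [T] codewords. *)
Lemma confusions_degree T f S w e d : ~~ crowded T f ->
  #|[set pq in confusions S w e f | d \in [set pq.1; pq.2]]| <= 2 * T.
Proof.
move=> /existsPn sparse.
pose Q := [set q | f q \in ball (addw (f d) e) tw].
have leQ : #|Q| <= T by rewrite leqNgt sparse.
have /subset_leq_card/leq_trans -> // : [set pq in confusions S w e f | d \in [set pq.1; pq.2]]
    \subset pair d @: Q :|: (pair^~ d) @: Q.
  apply/subsetP => -[p q]; rewrite inE => /andP[]; rewrite inE /= => /andP[_ fq].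
  rewrite !inE => /orP[] /eqP E; apply/orP; [left|right]; apply/imsetP.
    by exists q; rewrite ?E // inE E.
  by exists p; rewrite ?E // inE E ball_shift.
apply: (@leq_trans (#|pair d @: Q| + #|(pair^~ d) @: Q|)).
  by rewrite cardsU leq_subr.
by rewrite mul2n -addnn leq_add // (leq_trans (leq_imset_card _ _)).
Qed.

Variables (k beta : nat).
Hypothesis card_D : #|D| = 2 ^ k.
Hypothesis vol_le : vol n tw <= 2 ^ beta.
Notation F := #|{: {ffun D -> word n}}|.

(** A ball holds at most [2 ^ (k + beta - n)] codewords on average. The [T]-th power pays for the
    [2 ^ n] centers and for the final [2 ^ n]. *)
Lemma card_crowded T : 2 * n + (k + beta) * T <= n * T ->
  #|[set f | crowded T f]| * 2 ^ n <= F.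
Proof.
move=> big_n; apply: (@leq_pow2_cancel _ _ (n * T) (n + (k + beta) * T)); last by lia.
rewrite expnD -mulnA -[X in _ <= X * _]card_word.
apply: card_exists_le => y; rewrite expnM -card_word.
apply: leq_trans (@card_many_hits D _ D _ (ball y tw) T (@inj_id D)) _.
rewrite leq_mul2r card_ball card_D expnM expnD; apply/orP; right.
by case: T {big_n} => // T; rewrite leq_exp2r // leq_mul2l vol_le orbT.
Qed.

(** For given [S], [w], [e], at most [2 ^ (2 k + beta - tr - n)] confused pairs are expected, which
    is [2 ^ (k + beta + d - n)] times the threshold [2 ^ (k - tr - d)]. The [t]-th power of this
    ratio pays for the union over [S], [w], [e] and the final [2 ^ n], whence [4 * n]. The term
    [4 * T * t] covers pairs meeting those already chosen. *)
Lemma card_confusable tr d T t : tr + d <= k -> tr <= n ->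
  4 * n + (k + beta + d) * t <= n * t ->
  #|[set f | ~~ crowded T f &&
     [exists S : {set 'I_n}, exists w : word n, exists e : word n,
       (#|S| == tr) && (4 * T * t + 2 ^ (k - tr - d) <= #|confused f S w e|)]]| * 2 ^ n <= F.
Proof.
move=> trd_k tr_n big_n.
apply: (@leq_pow2_cancel _ _ ((n + n + (k - tr - d)) * t)
  (n + n + n + (k + k + (n - tr) + beta) * t));
  last by nia.
pose bad S w e f := (#|S| == tr) &&
  ([forall p, #|[set pq in confusions S w e f | p \in [set pq.1; pq.2]]| <= 2 * T] &&
   (2 ^ (k - tr - d) + 2 * T * (2 * t) <= #|confusions S w e f|)).
apply: (@leq_trans (#|[set f | [exists S, exists w, exists e, bad S w e f]]|
    * 2 ^ ((n + n + (k - tr - d)) * t))).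
  rewrite leq_mul2r; apply/orP; right; apply/subset_leq_card/subsetP => f.
  rewrite !inE => /andP[sparse /existsP[S /existsP[w /existsP[e /andP[cS big_f]]]]].
  apply/existsP; exists S; apply/existsP; exists w; apply/existsP; exists e.
  rewrite /bad cS /=; apply/andP; split.
    by apply/forallP => p; apply: confusions_degree.
  apply: leq_trans (card_confused_le f S w e); apply: leq_trans big_f.
  lia.
have -> : 2 ^ (n + n + n + (k + k + (n - tr) + beta) * t) * F =
    #|{set 'I_n}| * (#|{: word n}| * (#|{: word n}| * (2 ^ ((k + k + (n - tr) + beta) * t) * F))).
  by rewrite card_word card_subsets !expnD !mulnA.
apply: card_exists_le => S; apply: card_exists_le => w; apply: card_exists_le => e.
rewrite /bad; case: eqP => [cS|_]; last first.
  by rewrite (_ : [set _ | _] = set0) ?cards0 //; apply/setP => f; rewrite !inE.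
have cell_eq : #|cell S w| = 2 ^ (n - tr).
  by apply/eqP; rewrite -(eqn_pmul2r (expn_gt0 2 tr)) -{1}cS card_cell -expnD subnK.
have leY (x : word n) : #|ball (addw x e) tw| <= 2 ^ beta by rewrite card_ball.
have := @card_many_near_pairs D _ (cell S w) _ (2 ^ beta) (2 * T) (2 ^ (k - tr - d)) t leY.
by rewrite card_word card_D cell_eq -!expnD -!expnM (addnC (k - tr - d)) [k + k + _]addnA.
Qed.

End Codebooks.

(** One message has on average [2 ^ (l - tr) <= 2 ^ (- 4)] codewords in a cell. The [n]-th power,
    [2 ^ (- 4 n)], pays for the union over [S], [m], [w] and leaves [2 ^ (- n)]; this fixes the
    constant 4. *)
Lemma card_repeated n tr mu l :
  l + 4 <= tr -> tr <= n -> mu <= n ->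
  #|[set f : {ffun 'I_(2 ^ mu) * 'I_(2 ^ l) -> word n} |
      [exists S : {set 'I_n}, exists m : 'I_(2 ^ mu), exists w : word n,
        (#|S| == tr) && (n < #|[set j | f (m, j) \in cell S w]|)]]| * 2 ^ n
    <= #|{: {ffun 'I_(2 ^ mu) * 'I_(2 ^ l) -> word n}}|.
Proof.
move=> ltr trn mun; set F := #|{: _}|.
apply: (@leq_pow2_cancel _ _ (n * n) (n + mu + n + (l + (n - tr)) * n)); last by nia.
have -> : 2 ^ (n + mu + n + (l + (n - tr)) * n) * F =
    #|{: {set 'I_n}}| * (#|'I_(2 ^ mu)| * (#|{: word n}| * (2 ^ ((l + (n - tr)) * n) * F))).
  by rewrite card_word card_subsets card_ord !expnD !mulnA.
apply: card_exists_le => S; apply: card_exists_le => m; apply: card_exists_le => w.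
case: eqP => [cS|_]; last first.
  by rewrite (_ : [set _ | _] = set0) ?cards0 //; apply/setP => f; rewrite !inE.
have cell_eq : #|cell S w| = 2 ^ (n - tr).
  by apply/eqP; rewrite -(eqn_pmul2r (expn_gt0 2 tr)) -{1}cS card_cell -expnD subnK.
have pair_inj : injective (pair m : 'I_(2 ^ l) -> 'I_(2 ^ mu) * 'I_(2 ^ l)) by move=> i j [].
have := card_many_hits (cell S w) n pair_inj.
by rewrite card_word card_ord cell_eq -!expnD -!expnM.
Qed.

Section GoodCodebooks.
Variables (n tr tw b mu l : nat).
Notation codebook := {ffun 'I_(2 ^ mu) * 'I_(2 ^ l) -> word n}.

Definition good_codebook (f : codebook) :=
  [forall S : {set 'I_n}, (#|S| == tr) ==>
    [forall w : word n,
       [forall e : word n, #|confused tw f S w e| <= b] &&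
       [forall m : 'I_(2 ^ mu), #|[set j | f (m, j) \in cell S w]| <= n]]].

Lemma card_bad_codebook beta d T t : l + 4 <= tr -> tr <= n -> mu + l <= n ->
  vol n tw <= 2 ^ beta -> tr + d <= mu + l ->
  2 * n + (mu + l + beta) * T <= n * T ->
  4 * n + (mu + l + beta + d) * t <= n * t ->
  4 * T * t + 2 ^ (mu + l - tr - d) <= b.+1 ->
  #|[set f | ~~ good_codebook f]| * 2 ^ n <= 3 * #|{: codebook}|.
Proof.
move=> l4 trn muln vol_le trd bigT bigt leb.
have card_D : #|{: 'I_(2 ^ mu) * 'I_(2 ^ l)}| = 2 ^ (mu + l).
  by rewrite card_prod !card_ord expnD.
have leC := @card_crowded _ _ _ _ _ card_D vol_le T bigT.
have leB := @card_confusable _ _ _ _ _ card_D vol_le tr d T t trd trn bigt.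
have leA := @card_repeated n tr mu l l4 trn (leq_trans (leq_addr _ _) muln).
set A := [set f | _] in leA; set B := [set f | _] in leB; set C := [set f | _] in leC.
have /subset_leq_card sub : [set f | ~~ good_codebook f] \subset A :|: (B :|: C).
  apply/subsetP => f; rewrite inE => /forallPn[S]; rewrite negb_imply => /andP[cS].
  move=> /forallPn[w]; rewrite negb_and !inE.
  case: (boolP (crowded tw T f)) => [|sparse] /=; rewrite ?orbT // orbF.
  case/orP=> [/forallPn[e]|/forallPn[m]]; rewrite -ltnNge => gt_b; apply/orP; [right|left].
    apply/existsP; exists S; apply/existsP; exists w; apply/existsP; exists e.
    by rewrite cS (leq_trans leb).
  apply/existsP; exists S; apply/existsP; exists m; apply/existsP; exists w.
  by rewrite cS.
apply: (@leq_trans ((#|A| + (#|B| + #|C|)) * 2 ^ n)).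
  rewrite leq_mul2r; apply/orP; right; apply: leq_trans sub _.
  by have := cardsU A (B :|: C); have := cardsU B C; lia.
by rewrite !mulnDl !mulSn mul0n addn0 !leq_add.
Qed.
End GoodCodebooks.

(** * Finite sums of reals *)

HB.instance Definition _ := Monoid.isComLaw.Build R 0%R Rplus
  (fun x y z => esym (Rplus_assoc x y z)) Rplus_comm Rplus_0_l.
HB.instance Definition _ := Monoid.isComLaw.Build R 1%R Rmult
  (fun x y z => esym (Rmult_assoc x y z)) Rmult_comm Rmult_1_l.
HB.instance Definition _ := Monoid.isMulLaw.Build R 0%R Rmult Rmult_0_l Rmult_0_r.
HB.instance Definition _ := Monoid.isAddLaw.Build R Rmult Rplus
  Rmult_plus_distr_r Rmult_plus_distr_l.

Section Sums.
Local Open Scope R_scope.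
Variable T : finType.
Implicit Types (F G : T -> R) (P : pred T).

Lemma Rsum_le P F G : (forall t, P t -> F t <= G t) ->
  \big[Rplus/0]_(t | P t) F t <= \big[Rplus/0]_(t | P t) G t.
Proof.
move=> leFG; apply: (big_ind2 Rle) => [|x1 x2 y1 y2|//].
  exact: Rle_refl.
exact: Rplus_le_compat.
Qed.

Lemma Rsum_scal P F a : \big[Rplus/0]_(t | P t) (a * F t) = a * \big[Rplus/0]_(t | P t) F t.
Proof. by rewrite big_distrr. Qed.

Lemma Rsum_const P a : \big[Rplus/0]_(t | P t) a = INR #|P| * a.
Proof.
rewrite big_const; elim: #|P| => [|m IH]; first by rewrite Rmult_0_l.
by rewrite [LHS]/= IH S_INR; ring.
Qed.

Lemma Rsum_ge0 P F : (forall t, P t -> 0 <= F t) -> 0 <= \big[Rplus/0]_(t | P t) F t.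
Proof.
move=> F0; apply: (big_ind (fun x => 0 <= x)) => //; first exact: Rle_refl.
exact: Rplus_le_le_0_compat.
Qed.

Lemma sumR_ge F t : (forall t, 0 <= F t) -> F t <= sumR F.
Proof.
move=> F0; rewrite /sumR (bigD1 t) //= -[X in X <= _]Rplus_0_r.
by apply: Rplus_le_compat_l; apply: Rsum_ge0.
Qed.
End Sums.

(** * Entropy *)

Section Logs.
Local Open Scope R_scope.

Lemma ln2_gt0 : 0 < ln 2.
Proof. have := ln_lt_2; lra. Qed.

Lemma ln_le_sub1 x : 0 < x -> ln x <= x - 1.
Proof. move=> x0; have := exp_ineq1_le (ln x); rewrite exp_ln //; lra. Qed.

Lemma log2_le x y : 0 < x -> x <= y -> log2 x <= log2 y.
Proof.
move=> x0 xy; apply: Rmult_le_compat_r; first exact/Rlt_le/Rinv_0_lt_compat/ln2_gt0.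
by case: xy => [xy|->]; [apply/Rlt_le/ln_increasing|apply: Rle_refl].
Qed.

Lemma log2M x y : 0 < x -> 0 < y -> log2 (x * y) = log2 x + log2 y.
Proof. by move=> x0 y0; rewrite /log2 ln_mult //; field; have := ln2_gt0; lra. Qed.

Lemma log2V x : 0 < x -> log2 (/ x) = - log2 x.
Proof. by move=> x0; rewrite /log2 ln_Rinv //; field; have := ln2_gt0; lra. Qed.

Lemma log2_le_sub1 x : 0 < x -> log2 x <= (x - 1) / ln 2.
Proof.
move=> x0; apply: Rmult_le_compat_r; first exact/Rlt_le/Rinv_0_lt_compat/ln2_gt0.
exact: ln_le_sub1.
Qed.

Lemma INR_pow2 k : INR (2 ^ k)%N = 2 ^ k.
Proof. by elim: k => //= k IH; rewrite expnS mult_INR IH. Qed.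

Lemma log2_pow2 k : log2 (INR (2 ^ k)%N) = INR k.
Proof.
rewrite /log2 INR_pow2 ln_pow; last lra.
by field; have := ln2_gt0; lra.
Qed.
End Logs.

Section ConditionalEntropy.
Local Open Scope R_scope.
Variables (J V : finType) (p : J -> V -> R).
Hypothesis p_ge0 : forall m v, 0 <= p m v.
Hypothesis p_sum : sumR (fun m => sumR (fun v => p m v)) = 1.

Let P v := sumR (fun m => p m v).
Definition cond_entropy := sumR (fun m => sumR (fun v =>
  if Req_EM_T (p m v) 0 then 0 else p m v * log2 (P v / p m v))).

Let p_le_P m v : p m v <= P v.
Proof. exact: (sumR_ge (F := fun m => p m v)). Qed.

Let P_sum : sumR P = 1.
Proof. by rewrite -p_sum /sumR exchange_big. Qed.

(** Gibbs' inequality against the uniform law on messages: the linear bound on the logarithm of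
    [P v / (M * p m v)] leaves a correction of total 0. *)
Lemma cond_entropy_le : cond_entropy <= log2 (INR #|J|).
Proof.
have J0 : 0 < INR #|J|.
  apply: lt_0_INR; apply/ltP; case: (posnP #|J|) => // /eqP.
  move: p_sum; rewrite /sumR; case: (pickP (predT : pred J)) => [m _|J0].
    by rewrite (cardD1 m).
  by rewrite big_pred0 //; lra.
pose M := INR #|J|.
apply: (Rle_trans _ (sumR (fun m => sumR (fun v =>
    log2 M * p m v + / ln 2 * (/ M * P v + -1 * p m v))))).
  apply: Rsum_le => m _; apply: Rsum_le => v _; have := ln2_gt0 => ln2.
  case: Req_EM_T => [pm0|pn0] /=.
    rewrite pm0 !Rmult_0_r Rplus_0_l Rplus_0_r.
    apply: Rmult_le_pos; first exact/Rlt_le/Rinv_0_lt_compat.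
    apply: Rmult_le_pos; first exact/Rlt_le/Rinv_0_lt_compat.
    exact: Rle_trans (p_ge0 m v) (p_le_P m v).
  have p0 : 0 < p m v by have := p_ge0 m v; lra.
  have P0 : 0 < P v by have := p_le_P m v; lra.
  have -> : P v / p m v = M * (P v / (M * p m v)) by rewrite /M; field; split; lra.
  have q0 : 0 < P v / (M * p m v) by apply: Rdiv_lt_0_compat => //; apply: Rmult_lt_0_compat.
  rewrite log2M // Rmult_plus_distr_l (Rmult_comm (p m v) (log2 M)).
  apply: Rplus_le_compat_l.
  have := Rmult_le_compat_l _ _ _ (p_ge0 m v) (log2_le_sub1 q0).
  suff -> : p m v * ((P v / (M * p m v) - 1) / ln 2) = / ln 2 * (/ M * P v + -1 * p m v) by [].
  by rewrite /M; field; repeat split; lra.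
rewrite /sumR.
under eq_bigr => m _ do rewrite big_split !Rsum_scal big_split !Rsum_scal.
rewrite big_split !Rsum_scal big_split !Rsum_scal /= Rsum_const -!/(sumR _).
rewrite (_ : sumR (fun m => _) = 1) // (_ : sumR P = 1) //.
rewrite /M -[#|xpredT|]/#|J|; apply: Req_le; field; have := ln2_gt0; split; lra.
Qed.

(** The joint entropy is at least [- log2 a], while a view supported on [I] has entropy at most
    [log2 N]; the difference bounds the conditional entropy. *)
Lemma cond_entropy_ge a N (I : {set V}) : 0 < a -> 0 < N -> INR #|I| <= N ->
  (forall m v, p m v <= a) -> (forall m v, v \notin I -> p m v = 0) ->
  - log2 (a * N) <= cond_entropy.
Proof.
move=> a0 N0 leI lea supp; have ln2 := ln2_gt0.
(* The posterior of [m] given [v] times the weight [/ N] on views: a comparison weight of total at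
   most 1 for Gibbs' inequality. *)
pose q m v := if Req_EM_T (p m v) 0 then 0 else p m v / (P v * N).
have q_sum : sumR (fun m => sumR (fun v => q m v)) <= 1.
  rewrite /sumR exchange_big /=.
  apply: (Rle_trans _ (\big[Rplus/0]_v if v \in I then / N else 0)).
    apply: Rsum_le => v _; case: ifPn => vI; last first.
      rewrite big1; first exact: Rle_refl.
      by move=> m _; rewrite /q supp //; case: Req_EM_T.
    have P_ge0 : 0 <= P v by apply: Rsum_ge0.
    have [P0|Pn0] := Req_dec (P v) 0.
      rewrite big1; first exact/Rlt_le/Rinv_0_lt_compat.
      move=> m _; rewrite /q; case: Req_EM_T => // pn0.
      by have := p_le_P m v; have := p_ge0 m v; lra.
    apply: (Rle_trans _ (\big[Rplus/0]_m (/ (P v * N) * p m v))).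
      apply: Rsum_le => m _; rewrite /q; case: Req_EM_T => [pm0|_] /=.
        by rewrite pm0 Rmult_0_r; exact: Rle_refl.
      by rewrite /Rdiv Rmult_comm; exact: Rle_refl.
    rewrite Rsum_scal -/(sumR _) -/(P v); apply: Req_le; field; split; lra.
  rewrite -big_mkcond Rsum_const.
  apply: (Rle_trans _ (N * / N)); last by rewrite Rinv_r; lra.
  by apply: Rmult_le_compat_r => //; apply/Rlt_le/Rinv_0_lt_compat.
apply: (Rle_trans _ (sumR (fun m => sumR (fun v =>
    - log2 (a * N) * p m v + / ln 2 * (p m v + -1 * q m v))))).
  rewrite /sumR.
  under eq_bigr => m _ do rewrite big_split !Rsum_scal big_split !Rsum_scal.
  rewrite big_split !Rsum_scal big_split !Rsum_scal /= -!/(sumR _).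
  rewrite (_ : sumR (fun m => sumR (fun v => p m v)) = 1) // Rmult_1_r.
  rewrite -[X in X <= _]Rplus_0_r; apply: Rplus_le_compat_l.
  apply: Rmult_le_pos; first exact/Rlt_le/Rinv_0_lt_compat.
  by move: q_sum; rewrite /sumR; lra.
apply: Rsum_le => m _; apply: Rsum_le => v _; rewrite /q.
case: Req_EM_T => [pm0|pn0] /=; first by rewrite pm0 !Rmult_0_r Rplus_0_r Rmult_0_r Rplus_0_r; lra.
have p0 : 0 < p m v by have := p_ge0 m v; lra.
have P0 : 0 < P v by have := p_le_P m v; lra.
have PN0 : 0 < P v * N by apply: Rmult_lt_0_compat.
have aN0 : 0 < a * N by apply: Rmult_lt_0_compat.
have le1 : P v / a <= P v / p m v.
  by apply: Rmult_le_compat_l; [lra|apply: Rinv_le_contravar].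
apply: (Rle_trans _ (p m v * log2 (P v / a))); last first.
  apply: Rmult_le_compat_l => //; apply: log2_le => //; exact: Rdiv_lt_0_compat.
have -> : P v / a = / (a * N) * / (/ (P v * N)) by field; repeat split; lra.
have iPN0 : 0 < / (P v * N) by apply: Rinv_0_lt_compat.
rewrite (@log2M (/ (a * N))); [|exact: Rinv_0_lt_compat|exact: Rinv_0_lt_compat].
rewrite (log2V aN0) (log2V iPN0).
rewrite (Rmult_comm (- _)) [X in _ <= X]Rmult_plus_distr_l; apply: Rplus_le_compat_l.
have := Rmult_le_compat_l _ _ _ (p_ge0 m v) (log2_le_sub1 iPN0).
have -> : p m v * ((/ (P v * N) - 1) / ln 2) = - (/ ln 2 * (p m v + -1 * (p m v / (P v * N)))).
  by field; repeat split; lra.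
lra.
Qed.
End ConditionalEntropy.

(** * Entropy bound on the volume of a Hamming ball *)

Section Volume.
Local Open Scope R_scope.

(** Under independent bits that equal 1 with probability [p], each word of the ball has probability
    at least [exp (- (hbin p * INR n * ln 2))], and the total is 1. *)
Lemma vol_le_entropy n r (p : R) : 0 < p < / 2 -> INR r <= p * INR n ->
  INR (vol n r) <= exp (hbin p * INR n * ln 2).
Proof.
move=> p01 rpn.
pose F (i : 'I_n) (b : bool) := if b then p else 1 - p.
have total : \big[Rplus/0]_(e : word n) \big[Rmult/1]_i F i (e i) = 1.
  rewrite -bigA_distr_bigA big1 // => i _.
  by rewrite big_bool /F /=; lra.
have prodE (e : word n) : \big[Rmult/1]_i F i (e i) =
    exp (INR (weight e) * ln p + INR (n - weight e)%N * ln (1 - p)).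
  rewrite (bigID e) /= (eq_bigr (fun=> p)); last by move=> i ei; rewrite /F ei.
  rewrite [X in _ * X](eq_bigr (fun=> 1 - p)); last by move=> i /negbTE ei; rewrite /F ei.
  have iterE (P : pred 'I_n) x : 0 < x -> \big[Rmult/1]_(i | P i) x = exp (INR #|P| * ln x).
    move=> x0; rewrite big_const; elim: #|P| => [|m IH]; first by rewrite Rmult_0_l exp_0.
    rewrite [LHS]/= IH S_INR Rmult_plus_distr_r exp_plus Rmult_1_l exp_ln //; ring.
  rewrite !iterE; try lra; rewrite -exp_plus.
  have wE : #|[pred i | e i]| = weight e by apply: eq_card => i; rewrite !inE.
  have -> : #|(fun i => ~~ e i)| = (n - weight e)%N.
    have := cardC [pred i | e i]; rewrite card_ord wE => cardn.
    by rewrite -[X in (X - _)%N]cardn addKn; apply: eq_card => i; rewrite !inE.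
  by rewrite -wE.
have hE : exp (- (hbin p * INR n * ln 2)) = exp (p * INR n * ln p + (1 - p) * INR n * ln (1 - p)).
  by congr exp; rewrite /hbin /log2; field; have := ln2_gt0; lra.
suff : INR (vol n r) * exp (- (hbin p * INR n * ln 2)) <= 1.
  move=> H; apply: (Rmult_le_reg_r (exp (- (hbin p * INR n * ln 2)))); first exact: exp_pos.
  by rewrite -exp_plus Rplus_opp_r exp_0.
rewrite -total /vol cardsE -Rsum_const big_mkcond /=.
apply: Rsum_le => e _; case: ifP => we; last first.
  by rewrite prodE; apply/Rlt_le/exp_pos.
have exp_le x y : x <= y -> exp x <= exp y.
  by case=> [xy|->]; [apply/Rlt_le/exp_increasing|apply: Rle_refl].
rewrite prodE hE; apply: exp_le; rewrite minus_INR; last first.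
  by apply/leP; rewrite -[leqRHS]card_ord max_card.
have we_r : INR (weight e) <= p * INR n by apply: Rle_trans rpn; apply/le_INR/leP.
(* Since [p < / 2], lighter words are more likely, so weight [p * INR n] is the worst case. *)
have ln_p : ln p <= ln (1 - p) by apply/Rlt_le/ln_increasing; lra.
nra.
Qed.
End Volume.

(** * Counting views, and failures of the decoder *)

Lemma sum_card_fibers (J V : finType) (h : J -> V) : \sum_v #|[set j | h j == v]| = #|J|.
Proof.
rewrite -sum1_card (partition_big h predT) //; apply: eq_bigr => v _.
by rewrite sum1dep_card.
Qed.

Lemma INR_sum (T : finType) (F : T -> nat) :
  INR (\sum_t F t) = \big[Rplus/0%R]_t INR (F t).
Proof. by apply: (big_morph INR) => // x y; rewrite plus_INR. Qed.

Lemma card_views n (S : {set 'I_n}) : #|vmask S @: [set: word n]| = 2 ^ #|S|.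
Proof.
have le_S : #|S| <= n by rewrite -[leqRHS]card_ord max_card.
apply/eqP; rewrite -(eqn_pmul2r (expn_gt0 2 (n - #|S|))) -expnD subnKC // -(card_word n).
rewrite -[X in _ == X]cardsT -[X in _ == X]sum1_card (partition_big_imset (vmask S)) /=.
rewrite -sum_nat_const; apply/eqP.
apply: eq_bigr => _ /imsetP[w _ ->].
rewrite sum1dep_card; apply/eqP.
rewrite -(eqn_pmul2r (expn_gt0 2 #|S|)) -expnD subnK // -(card_cell S w).
by rewrite eqn_pmul2r ?expn_gt0 //; apply/eqP/eq_card => x; rewrite !inE.
Qed.

Lemma nn_dec_fail n M L (c : scode n M L) m j y : nn_dec c y != Some m ->
  exists2 q, q != (m, j) & hdist (c q.1 q.2) y <= hdist (c m j) y.
Proof.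
rewrite /nn_dec; case: pickP => [p /forallP min_p|no_min] /=.
  move=> pm; exists p; last exact: (min_p (m, j)).
  by apply: contraNneq pm => ->.
(* The decoder never answers [None] here: a closest codeword exists. *)
move=> _; pose p0 := [arg min_(p < (m, j)) hdist (c p.1 p.2) y].
have := no_min p0; rewrite /p0; case: arg_minnP => //= p _ min_p /negbT /negP[].
by apply/forallP => q; apply: min_p.
Qed.

(** * Good codebooks are reliable and secret *)

Section GoodIsSecure.
Local Open Scope R_scope.
Variables (n tr tw b mu l : nat).
Variable f : {ffun 'I_(2 ^ mu) * 'I_(2 ^ l) -> word n}.
Hypothesis good_f : good_codebook tr tw b f.
Let c : scode n (2 ^ mu) (2 ^ l) := fun m j => f (m, j).

Let pow2_gt0 k : 0 < INR (2 ^ k).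
Proof. by apply: lt_0_INR; apply/ltP; rewrite expn_gt0. Qed.

Let confused_le (S : {set 'I_n}) w e : #|S| = tr -> (#|confused tw f S w e| <= b)%N.
Proof.
by move=> cS; have /forallP/(_ S) := good_f; rewrite cS eqxx => /forallP/(_ w)/andP[/forallP].
Qed.

Let cell_le (S : {set 'I_n}) w m : #|S| = tr -> (#|[set j | f (m, j) \in cell S w]| <= n)%N.
Proof.
by move=> cS; have /forallP/(_ S) := good_f; rewrite cS eqxx => /forallP/(_ w)/andP[_ /forallP].
Qed.

(** The error law depends only on the view. For a fixed view and error at most [b] codewords fail,
    so averaging over errors still charges each of the at most [2 ^ tr] views with [b] codewords. *)
Lemma good_reliable : reliable c tr tw (INR b * INR (2 ^ tr) / INR (2 ^ (mu + l))).
Proof.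
move=> S cS A advA.
pose kap := / INR (2 ^ mu) * / INR (2 ^ l).
have kap0 : 0 < kap by apply: Rmult_lt_0_compat; apply: Rinv_0_lt_compat.
pose conf p e := [exists q, (q != p) && (f q \in ball (addw (f p) e) tw)].
pose view_of p := vmask S (f p).
have A0 v e : 0 <= A v e by have [A0 _] := advA v.
apply: (Rle_trans _ (\big[Rplus/0]_p \big[Rplus/0]_e
    (kap * (A (view_of p) e * if conf p e then 1 else 0)))).
  rewrite /err_prob /sumR pair_big /=; apply: Rsum_le => -[m j] _ /=.
  apply: Rsum_le => e _; rewrite -/kap Rmult_assoc.
  apply: Rmult_le_compat_l; first exact: Rlt_le.
  rewrite /c -/(view_of (m, j)).
  (* The weight bound on [e] is available only for errors of nonzero probability. *)
  have [->|An0] := Req_dec (A (view_of (m, j)) e) 0.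
    by rewrite !Rmult_0_l; apply: Rle_refl.
  apply: Rmult_le_compat_l; first exact: A0.
  case: ifPn => [_|fail]; first by case: ifP => _; lra.
  rewrite ifT; first exact: Rle_refl.
  have [q nq le_q] := nn_dec_fail j fail.
  apply/existsP; exists q; rewrite nq inE /=; case: q nq le_q => m' j' _ /= le_q.
  apply: leq_trans le_q _; rewrite hdistE addwA.
  have [_ [_ /(_ e An0)]] := advA (view_of (m, j)).
  by congr (weight _ <= _)%N; apply/ffunP => i; rewrite !ffunE; case: (f _ i).
pose I := view_of @: [set: 'I_(2 ^ mu) * 'I_(2 ^ l)].
have I_le : (#|I| <= 2 ^ tr)%N.
  rewrite -cS -card_views; apply/subset_leq_card/subsetP => _ /imsetP[p _ ->].
  by apply: imset_f; rewrite inE.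
rewrite (eq_bigl (mem [set: 'I_(2 ^ mu) * 'I_(2 ^ l)])); last by move=> p; rewrite !inE.
rewrite (partition_big_imset view_of) /= -/I.
apply: (Rle_trans _ (\big[Rplus/0]_(v in I) (kap * INR b))); last first.
  rewrite Rsum_const; apply: (Rle_trans _ (INR (2 ^ tr) * (kap * INR b))).
    apply: Rmult_le_compat_r; last exact/le_INR/leP.
    by apply: Rmult_le_pos; [apply: Rlt_le|apply: pos_INR].
  rewrite /kap expnD mult_INR; apply: Req_le; field.
  by split; apply: Rgt_not_eq.
apply: Rsum_le => _ /imsetP[p0 _ ->].
rewrite exchange_big /=.
apply: (Rle_trans _ (\big[Rplus/0]_e (kap * INR b * A (view_of p0) e))); last first.
  rewrite Rsum_scal -/(sumR _) -/(sumR (A _)).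
  by have [_ [-> _]] := advA (view_of p0); rewrite Rmult_1_r; apply: Rle_refl.
apply: Rsum_le => e _.
apply: (Rle_trans _ (\big[Rplus/0]_(p in confused tw f S (f p0) e) (kap * A (view_of p0) e))).
  rewrite [X in X <= _]big_mkcond [X in _ <= X]big_mkcond; apply: Rsum_le => p _.
  have -> : (p \in confused tw f S (f p0) e) = (view_of p == view_of p0) && conf p e.
    by rewrite inE [_ \in cell _ _]inE.
  rewrite in_setT /=.
  case: eqP => [->|_] /=; last exact: Rle_refl.
  by case: (conf p e); rewrite ?Rmult_0_r ?Rmult_1_r; apply: Rle_refl.
rewrite Rsum_const.
apply: (Rle_trans _ (INR b * (kap * A (view_of p0) e))).
  apply: Rmult_le_compat_r; last by apply/le_INR/leP/confused_le.
  by apply: Rmult_le_pos; [apply: Rlt_le|apply: A0].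
by apply: Req_le; ring.
Qed.

(** Each joint probability is at most [n * 2 ^ (- mu - l)] and there are [2 ^ tr] views, so at least
    [mu + l - tr - log2 n] bits stay hidden, that is, [mu - 4 - log2 n]. *)
Lemma good_secret : (0 < n)%N -> (tr = l + 4)%N -> secret c tr ((4 + log2 (INR n)) / INR n).
Proof.
move=> n0 trE S cS.
have n_gt0 : 0 < INR n by apply/lt_0_INR/ltP.
pose kap := / INR (2 ^ mu) * / INR (2 ^ l).
have kap0 : 0 < kap by apply: Rmult_lt_0_compat; apply: Rinv_0_lt_compat.
have p_ge0 m v : 0 <= pjoint c S m v.
  by apply: Rmult_le_pos; [apply: Rlt_le|apply: pos_INR].
have p_sum : sumR (fun m => sumR (fun v => pjoint c S m v)) = 1.
  rewrite /sumR; under eq_bigr => m _ do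
    rewrite /pjoint Rsum_scal -INR_sum sum_card_fibers card_ord.
  rewrite Rsum_const (_ : #|_| = 2 ^ mu)%N; last exact: card_ord.
  by field; split; apply: Rgt_not_eq.
have le_M : condH c S <= log2 (INR #|{: 'I_(2 ^ mu)}|) := cond_entropy_le p_ge0 p_sum.
have ge_M : - log2 (kap * INR n * INR (2 ^ tr)) <= condH c S.
  apply: (cond_entropy_ge p_ge0 p_sum (I := vmask S @: [set: word n])) => //.
  - exact: Rmult_lt_0_compat.
  - by rewrite card_views cS; apply: Rle_refl.
  - move=> m v; apply: Rmult_le_compat_l; first exact: Rlt_le.
    apply/le_INR/leP; case: (posnP #|[set j | vmask S (c m j) == v]|) => [->//|].
    rewrite card_gt0 => /set0Pn[j0]; rewrite inE => /eqP <-.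
    by apply: leq_trans (cell_le (c m j0) m cS); apply/subset_leq_card/subsetP => j; rewrite !inE.
  - move=> m v vI; rewrite /pjoint (_ : [set _ | _] = set0) ?cards0 ?Rmult_0_r //.
    apply/setP => j; rewrite !inE; apply: contraNF vI => /eqP <-.
    by apply: imset_f; rewrite inE.
rewrite card_ord log2_pow2 in le_M.
have log_kap : log2 (kap * INR n * INR (2 ^ tr)) = - INR mu - INR l + log2 (INR n) + INR tr.
  rewrite !log2M ?log2V ?log2_pow2 //; try exact: Rinv_0_lt_compat; last exact: Rmult_lt_0_compat.
rewrite log_kap trE plus_INR in ge_M.
have log_n : 0 <= log2 (INR n).
  rewrite (_ : 0 = log2 1); last by rewrite /log2 ln_1 /Rdiv Rmult_0_l.
  by apply: log2_le; [lra|apply: (le_INR 1); apply/leP].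
rewrite /rate log2_pow2 -Rdiv_minus_distr Rabs_mult (Rabs_pos_eq (/ _)); last first.
  exact/Rlt_le/Rinv_0_lt_compat.
apply: Rmult_le_compat_r; first exact/Rlt_le/Rinv_0_lt_compat.
have {}ge_M : INR mu - 4 - log2 (INR n) <= condH c S by move: ge_M => /=; lra.
by apply: Rabs_le; lra.
Qed.

End GoodIsSecure.

(* [Defs] parses [2 ^ k] as [Nat.pow]. *)
Lemma Nat_powE m k : Nat.pow m k = m ^ k.
Proof. by elim: k => //= k ->; rewrite expnS. Qed.

Lemma pbP (P : Prop) : reflect P (pb P).
Proof. by rewrite /pb; case: ClassicalEpsilon.excluded_middle_informative => ?; constructor. Qed.

Lemma CPiE n M L (cb : {ffun 'I_M * 'I_L -> word n}) (s : {perm 'I_M * 'I_L}) :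
  CPi cb s = fun m j => [ffun p => cb (s p)] (m, j).
Proof.
by apply: functional_extensionality => m; apply: functional_extensionality => j; rewrite ffunE.
Qed.

(** For each permutation, reindexing is a bijection of codebooks; a random partition of a random
    code is therefore again a uniform codebook. *)
Lemma card_permuted (D W : finType) (G : pred {ffun D -> W}) :
  #|[set cs : {ffun D -> W} * {perm D} | G [ffun p => cs.1 (cs.2 p)]]| =
  #|[set f | G f]| * #|{: {perm D}}|.
Proof.
pose push (cs : {ffun D -> W} * {perm D}) := ([ffun p => cs.1 (cs.2 p)], cs.2).
have push_inj : injective push.
  case=> f s [g t] [/ffunP fg st]; rewrite -{}st in fg *; congr pair.
  by apply/ffunP => p; have := fg ((s^-1)%g p); rewrite !ffunE permKV.
have push_bij : bijective push by apply: injF_bij.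
rewrite -cardsT -cardsX -(card_imset _ push_inj); apply: eq_card => fs.
have [pull pullK pushK] := push_bij.
rewrite -(pushK fs) (mem_imset _ _ push_inj) !inE andbT.
by [].
Qed.

(** * Probabilities near 1, rounding and limits *)

Section Reals.
Local Open Scope R_scope.

Lemma uprob_near1 (T : finType) (E : pred T) K n : (0 < n)%N -> (0 < #|T|)%N ->
  (#|[set x | ~~ E x]| * 2 ^ n <= K * #|T|)%N -> Rabs (uprob E - 1) <= INR K / INR n.
Proof.
move=> n0 T0 bad; have n_gt0 : 0 < INR n by apply/lt_0_INR/ltP.
have T_gt0 : 0 < INR #|T| by apply/lt_0_INR/ltP.
have T_split : INR #|T| = INR #|[set x | E x]| + INR #|[set x | ~~ E x]|.
  rewrite -plus_INR -(cardsC [set x | E x]); congr (INR (_ + _)%N).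
  by apply: eq_card => x; rewrite !inE.
have -> : uprob E - 1 = - (INR #|[set x | ~~ E x]| / INR #|T|).
  by rewrite /uprob; apply: (Rmult_eq_reg_r (INR #|T|)); [field_simplify; lra|lra].
rewrite Rabs_Ropp Rabs_pos_eq; last first.
  by apply: Rmult_le_pos; [apply: pos_INR|apply/Rlt_le/Rinv_0_lt_compat].
have {}bad : INR #|[set x | ~~ E x]| * INR n <= INR K * INR #|T|.
  rewrite -!mult_INR; apply/le_INR/leP; apply: leq_trans bad.
  by rewrite leq_mul2l ltnW ?orbT // ltn_expl.
apply: (Rmult_le_reg_r (INR n * INR #|T|)); first exact: Rmult_lt_0_compat.
by field_simplify; lra.
Qed.

Lemma Z_to_nat_INR z : 0 <= IZR z -> INR (Z.to_nat z) = IZR z.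
Proof. by move=> /le_IZR z0; rewrite INR_IZR_INZ Z2Nat.id. Qed.

Lemma floorR_bounds x : 0 <= x -> INR (floorR x) <= x < INR (floorR x) + 1.
Proof.
move=> x0; have [le_x gt_x] := base_Int_part x.
rewrite /floorR Z_to_nat_INR; first lra.
suff : (-1 < Int_part x)%Z by move=> ?; apply: IZR_le; lia.
by apply: lt_IZR; lra.
Qed.

Lemma exists_ceil x : 0 <= x -> exists k, x <= INR k <= x + 1.
Proof.
move=> x0; exists (Z.to_nat (up x)); have [up_gt up_le] := archimed x.
by rewrite Z_to_nat_INR; lra.
Qed.

Lemma hbin_ge0 p : 0 < p < 1 -> 0 <= hbin p.
Proof.
move=> p01; have log_le0 x : 0 < x < 1 -> log2 x <= 0.
  move=> x01; apply: (Rle_trans _ (log2 1)); first by apply: log2_le; lra.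
  by rewrite /log2 ln_1 /Rdiv Rmult_0_l; lra.
have := log_le0 p p01; have := log_le0 (1 - p) ltac:(lra); rewrite /hbin; nra.
Qed.

Lemma Un_cv_log_div A : 0 <= A -> Un_cv (fun n => (A + log2 (INR n)) / INR n) 0.
Proof.
move=> A0 e e0.
(* With [s = sqrt n], [ln n = 2 ln s <= 2 s] and [ln 2 > 1 / 2] give [log2 n <= 4 s]; the quotient
   is at most [(A + 4) / s], which is below [e] once [s > B]. *)
pose B := (A + 4) / e.
have B0 : 0 < B by apply: Rdiv_lt_0_compat; lra.
have [N [N_ge _]] := exists_ceil (x := B ^ 2 + 2) ltac:(nra).
exists N => n nN; have {}N_ge : B ^ 2 + 2 <= INR n by have := le_INR _ _ nN; lra.
have n1 : 1 <= INR n by nra.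
pose s := sqrt (INR n).
have ss : s * s = INR n by apply: sqrt_sqrt; lra.
have s1 : 1 <= s by rewrite -sqrt_1; apply: sqrt_le_1; lra.
have sB : B < s by nra.
have ln_s : ln (INR n) <= 2 * s.
  by rewrite -ss ln_mult; try lra; have := @ln_le_sub1 s; lra.
have ln2 := ln_lt_2.
have ln_n : 0 <= ln (INR n).
  by case: n1 => [n1|<-]; rewrite -ln_1; [apply/Rlt_le/ln_increasing; lra|apply: Rle_refl].
have log_s : 0 <= log2 (INR n) <= 4 * s.
  split; first by apply: Rmult_le_pos => //; apply/Rlt_le/Rinv_0_lt_compat; lra.
  apply: (Rmult_le_reg_r (ln 2)); first lra.
  rewrite /log2 /Rdiv Rmult_assoc Rinv_l; nra.
have BE : B * e = A + 4 by rewrite /B; field; lra.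
rewrite /Rdist Rminus_0_r Rabs_pos_eq; last first.
  by apply: Rmult_le_pos; [lra|apply/Rlt_le/Rinv_0_lt_compat; lra].
apply: (Rmult_lt_reg_r (INR n)); first lra.
rewrite /Rdiv Rmult_assoc Rinv_l; last lra.
have lt1 : B * e * s < s * e * s.
  by apply: Rmult_lt_compat_r; [lra|apply: Rmult_lt_compat_r].
rewrite BE in lt1; rewrite -ss in log_s *; nra.
Qed.
End Reals.

(** * Choice of the parameters *)

Section Main.
Variables (n k beta g tr tw C : nat).
Let d := g./2.
Let T := 2 * C.
Let t := 8 * C.
Let b := 4 * T * t + 2 ^ (k - tr - d).

(** The slack [g] is split in two: [d], about half, lowers the confusion threshold, and the rest
    drives the tail bound. With [n <= C * g], [T = 2 * C] gives [g * T >= 2 * n] and [t = 8 * C]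
    gives [(g - d) * t >= 4 * n]. *)
Lemma confusion_budget : k + beta + g <= n -> tr + g <= k -> n <= C * g ->
  [/\ 2 * n + (k + beta) * T <= n * T, 4 * n + (k + beta + d) * t <= n * t
    & b * 2 ^ tr * n <= (4 * T * t + 1) * (2 * C) * 2 ^ k].
Proof.
move=> kbg trg nCg; have dE := odd_double_half g.
have d_le : d.*2 <= g by rewrite -[leqRHS]dE leq_addl.
have d_ge : g <= d.*2.+1 by rewrite -[leqLHS]dE; case: (odd g); rewrite ?add1n ?add0n.
split; first by rewrite /T; nia.
  by rewrite /t; nia.
have le1 : b * 2 ^ tr <= (4 * T * t + 1) * 2 ^ (k - d).
  have -> : b * 2 ^ tr = 4 * T * t * 2 ^ tr + 2 ^ (k - d).
    by rewrite mulnDl -expnD; congr (_ + 2 ^ _); lia.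
  by rewrite mulnDl mul1n leq_add2r leq_mul2l leq_exp2l //; apply/orP; right; lia.
(* Here [g <= 2 * d + 1] and [d < 2 ^ d]; the factor [2 ^ d] thus makes the error probability
   [O(1 / n)]. *)
have le2 : n <= 2 * C * 2 ^ d.
  have := ltn_expl d (isT : 1 < 2); nia.
apply: leq_trans (leq_mul le1 le2) _.
have -> : 2 ^ k = 2 ^ (k - d) * 2 ^ d by rewrite -expnD subnK //; lia.
by rewrite mulnACA.
Qed.
End Main.

Lemma good_prob_near1 (rr rw eps : R) n k l tr beta g C (delta : R) :
  let T := 2 * C in let t := 8 * C in
  k = kbits rw eps n -> tr = floorR (rr * INR n) -> l + 4 = tr ->
  k + beta + g <= n -> tr + g <= k -> n <= C * g -> 0 < n ->
  vol n (floorR (rw * INR n)) <= 2 ^ beta ->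
  (INR ((4 * T * t + 1) * (2 * C)) / INR n <= delta)%R ->
  ((4 + log2 (INR n)) / INR n <= delta)%R ->
  (1 - hbin rw - rr - eps <= INR (k - l) / INR n)%R ->
  (Rabs (good_prob rr rw eps 4 n delta - 1) <= 3 / INR n)%R.
Proof.
move=> T t kE trE ltr kbg trg nCg n0 vol_le le_rel le_sec le_rate.
have [bigT bigt b_le] := confusion_budget kbg trg nCg.
rewrite /good_prob /lbits -kE -trE (_ : tr - 4 = l); last by lia.
rewrite !Nat_powE; set tw := floorR _.
pose mu := k - l; have kmu : mu + l = k by rewrite /mu subnK //; lia.
rewrite -/mu in le_rate *.
set b := (4 * _ * _ + _) in b_le.
have tr_n : tr <= n by lia.
have [l4 mul_n] : l + 4 <= tr /\ mu + l <= n by split; lia.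
have trd : tr + g./2 <= mu + l by rewrite kmu; have := leq_half_double g g; lia.
rewrite -kmu in bigT bigt b_le.
have leb : 4 * (2 * C) * (8 * C) + 2 ^ (mu + l - tr - g./2) <= b.+1 by rewrite /b kmu.
have bad := card_bad_codebook l4 tr_n mul_n vol_le trd bigT bigt leb.
have n_gt0 : (0 < INR n)%R by apply/lt_0_INR/ltP.
have pow_gt0 j : (0 < INR (2 ^ j))%R by apply/lt_0_INR/ltP; rewrite expn_gt0.
rewrite [3%R](_ : _ = INR 3); last by rewrite /=; lra.
apply: uprob_near1 => //.
  by apply/card_gt0P; exists ([ffun=> [ffun=> false]], 1%g).
set N := #|_|; rewrite card_prod mulnA.
apply: (@leq_trans (#|[set f : {ffun 'I_(2 ^ mu) * 'I_(2 ^ l) -> word n} |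
     ~~ good_codebook tr tw b f]| * #|{: {perm 'I_(2 ^ mu) * 'I_(2 ^ l)}}| * 2 ^ n)); last first.
  by rewrite mulnAC leq_mul2r bad orbT.
rewrite leq_mul2r -card_permuted; apply/orP; right.
apply/subset_leq_card/subsetP => -[cb s]; rewrite !inE /=; apply: contraNN => good.
apply/pbP; split; first by rewrite /rate log2_pow2.
rewrite CPiE; split.
  move=> S cS A advA; apply: Rle_trans (good_reliable good cS advA) _.
  apply: Rle_trans le_rel; apply: (Rmult_le_reg_r (INR n * INR (2 ^ (mu + l)))).
    exact: Rmult_lt_0_compat.
  move/leP/le_INR: b_le; rewrite !mult_INR => b_le.
  have := pow_gt0 (mu + l); rewrite /Rdiv => pow0.
  field_simplify; lra.
move=> S cS; apply: Rle_trans (good_secret good n0 _ cS) le_sec.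
by rewrite ltr.
Qed.

Theorem theorem4p10 (rr rw eps : R) :
  (0 < rr < 1)%R -> (0 < rw < / 2)%R -> (0 < eps)%R ->
  (rr < 1 - hbin rw - 2 * eps)%R ->
  exists c : nat, exists delta : nat -> R,
    Un_cv delta 0%R /\
    Un_cv (fun n => good_prob rr rw eps c n (delta n)) 1%R.
Proof.
move=> rr01 rw0 eps0 rr_lt; exists 4.
have h0 : (0 <= hbin rw)%R by apply: hbin_ge0; lra.
have inv_eps : (0 < / eps)%R by apply: Rinv_0_lt_compat.
have inv_rr : (0 < / rr)%R by apply: Rinv_0_lt_compat; lra.
have epsV : (eps * / eps = 1)%R by apply: Rinv_r; lra.
have rrV : (rr * / rr = 1)%R by apply: Rinv_r; lra.
(* The slack [g] will exceed [eps * n - 2], hence be at least [eps * n / 2] once [eps * n >= 4];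
   this gives [n <= C * g]. *)
have [C [C_ge _]] := @exists_ceil (2 * / eps)%R ltac:(lra).
pose K := INR ((4 * (2 * C) * (8 * C) + 1) * (2 * C)).
have K0 : (0 <= K)%R by apply: pos_INR.
(* One [delta] dominates both the decoding error [K / n] and the leakage [(4 + log2 n) / n]. *)
exists (fun n => (K + 4 + log2 (INR n)) / INR n)%R; split.
  by apply: Un_cv_log_div; lra.
move=> e e0.
have inv_e : (0 < / e)%R by apply: Rinv_0_lt_compat.
have eV : (e * / e = 1)%R by apply: Rinv_r; lra.
(* The summands ensure in turn [eps * n >= 4], [tr > 4], [3 / n < e] and [n >= 1]. *)
have [n0 [n0_ge _]] := @exists_ceil (4 * / eps + 5 * / rr + 4 * / e + 1)%R ltac:(lra).
exists n0 => n /le_INR n0n.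
have n1 : (1 <= INR n)%R by lra.
have n_pos : 0 < n by apply/ltP/INR_lt; rewrite /=; lra.
have eps_n : (4 <= eps * INR n)%R by nra.
have rr_n : (5 <= rr * INR n)%R by nra.
have e_n : (3 < e * INR n)%R by nra.
have [tr_le tr_gt] := @floorR_bounds (rr * INR n)%R ltac:(lra).
have [k_le k_gt] := @floorR_bounds ((1 - hbin rw - eps) * INR n)%R ltac:(nra).
have [tw_le _] := @floorR_bounds (rw * INR n)%R ltac:(nra).
have [beta [beta_ge beta_le]] := @exists_ceil (hbin rw * INR n)%R ltac:(nra).
(* The [- 1] pays for rounding [beta] up in [k + beta + g <= n] and for rounding [k] down in
   [tr + g <= k]; the latter uses [rr + eps < 1 - hbin rw - eps]. *)
have [g_le g_gt] := @floorR_bounds (eps * INR n - 1)%R ltac:(lra).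
set g := floorR (eps * INR n - 1) in g_le g_gt.
set k := floorR ((1 - hbin rw - eps) * INR n) in k_le k_gt.
set tr := floorR (rr * INR n) in tr_le tr_gt.
have tr4 : 4 < tr by apply/ltP/INR_lt; rewrite /=; lra.
have ltr : tr - 4 + 4 = tr by lia.
have kbg : k + beta + g <= n by apply/leP/INR_le; rewrite !plus_INR; nra.
have trg : tr + g <= k by apply/leP/INR_le; rewrite !plus_INR; nra.
have nCg : n <= C * g.
  apply/leP/INR_le; rewrite mult_INR.
  have lin : (eps * INR n / 2 <= INR g)%R by lra.
  have := Rmult_le_compat _ _ _ _ (_ : 0 <= 2 * / eps)%R (_ : 0 <= eps * INR n / 2)%R C_ge lin.
  suff -> : (2 * / eps * (eps * INR n / 2) = INR n)%R by apply; nra.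
  by field; lra.
have vol_le : vol n (floorR (rw * INR n)) <= 2 ^ beta.
  apply/leP/INR_le; apply: Rle_trans (vol_le_entropy rw0 tw_le) _.
  have ln2 := ln2_gt0.
  rewrite INR_pow2 -[(2 ^ beta)%R]exp_ln; last by apply: pow_lt; lra.
  rewrite ln_pow; last lra.
  have : (hbin rw * INR n * ln 2 <= INR beta * ln 2)%R by nra.
  by case=> [lt|->]; [apply/Rlt_le/exp_increasing|apply: Rle_refl].
have inv_n : (0 < / INR n)%R by apply: Rinv_0_lt_compat; lra.
have log_n : (0 <= log2 (INR n))%R.
  rewrite (_ : 0 = log2 1)%R; last by rewrite /log2 ln_1 /Rdiv Rmult_0_l.
  by apply: log2_le; lra.
rewrite /Rdist; apply: Rle_lt_trans.
  apply: (@good_prob_near1 rr rw eps n k (tr - 4) tr beta g C) => //.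
  - by apply: Rmult_le_compat_r; rewrite -/K; lra.
  - by apply: Rmult_le_compat_r; lra.
  - apply: (Rmult_le_reg_r (INR n)); first lra.
    rewrite /Rdiv Rmult_assoc Rinv_l; last lra.
    rewrite minus_INR; last by apply/leP; lia.
    by rewrite minus_INR; [rewrite /=; nra|apply/leP; lia].
apply: (Rmult_lt_reg_r (INR n)); first lra.
by rewrite /Rdiv Rmult_assoc Rinv_l; lra.
Qed.
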